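(* There exists a stochastic block model $\mathrm{SBM}(n;p,Q)$ on $2$ balanced communities (i.e. $k=2$, $p=(1/2,1/2)$, with $Q$ allowed to depend on $n$) with the following property. It can be distinguished from $\mathbb{G}(n,1/2)$ with high probability via the signed count of $\mathrm{Star}_1$, but not via the signed count of any other connected graph of constant size (with at least one edge).
   Context: Graphs are finite, simple and undirected. $\mathrm{Star}_1$ is a single edge. $\mathbb{G}(n,1/2)$ is the Erdős–Rényi random graph. A stochastic block model on $k$ communities is given by a probability vector $p\in(0,1]^k$ and a symmetric matrix $Q\in[-1,1]^{k\times k}$. A sample $\mathbf{G}\sim\mathrm{SBM}(n;p,Q)$ is an $n$-vertex graph produced by drawing i.i.d. labels $\mathbf{x}_1,\dots,\mathbf{x}_n\in[k]$ with pmf $p$, and then including each edge $(i,j)$ independently with probability $(1+Q_{\mathbf{x}_i,\mathbf{x}_j})/2$. The signed count of $H$ in an $n$-vertex graph $G$ with edge indicators $G_{ij}$ is $\mathrm{SC}_H(G)=\sum_{H_1\sim H}\prod_{(i,j)\in E(H_1)}(2G_{ij}-1)$, the sum over all subgraphs $H_1$ of $K_n$ isomorphic to $H$. With $f=\mathrm{SC}_H$ and $M_n=\max(\mathrm{Var}_{\mathbb{G}(n,1/2)}[f]^{1/2},\mathrm{Var}_{\mathbb{P}_n}[f]^{1/2})$, the signed count of $H$ distinguishes $\mathbb{P}_n$ from $\mathbb{G}(n,1/2)$ (with high probability) if $|\mathbb{E}_{\mathbb{P}_n}f-\mathbb{E}_{\mathbb{G}(n,1/2)}f|=\omega(M_n)$,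 and it fails to distinguish (''not via'') if $|\mathbb{E}_{\mathbb{P}_n}f-\mathbb{E}_{\mathbb{G}(n,1/2)}f|=o(M_n)$, as $n\to\infty$. *)

(* Defs.v *)
From HB Require Import structures.
From mathcomp Require Import all_boot all_order all_algebra.
From mathcomp Require Import all_classical all_reals all_analysis.

Set Implicit Arguments.
Unset Strict Implicit.
Unset Printing Implicit Defensive.

Import Order.TTheory GRing.Theory Num.Theory.
Import numFieldNormedType.Exports.

Local Open Scope ring_scope.

(* A simple undirected graph on the vertex type V: its edges are two-element
   sets of vertices, so that there are neither loops nor multiple edges. *)
Record sgraph (V : finType) := SGraph {
  edges : {set {set V}};
  _ : edges \subset [set e : {set V} | #|e| == 2] }.

HB.instance Definition _ (V : finType) := [isSub for @edges V].
HB.instance Definition _ (V : finType) := [Finite of sgraph V by <:].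

(* [set x; x] is a singleton, hence adj is irreflexive. *)
Definition adj (V : finType) (G : sgraph V) : rel V :=
  fun x y => [set x; y] \in edges G.

Definition connected_graph (V : finType) (G : sgraph V) : Prop :=
  (0 < #|V|)%N /\ forall x y : V, connect (adj G) x y.

Definition isomorphic (V W : finType) (G : sgraph V) (H : sgraph W) : Prop :=
  exists2 f : V -> W, bijective f & forall x y, adj G x y = adj H (f x) (f y).

Fact star1_subproof :
  [set [set: 'I_2]] \subset [set e : {set 'I_2} | #|e| == 2].
Proof. by rewrite finset.sub1set finset.inE finset.cardsT card_ord. Qed.

Definition star1 : sgraph 'I_2 := SGraph star1_subproof.

(* A subgraph of K_n is a pair (vertex set, edge set).  Those isomorphic to H
   are exactly the images of H under injective maps of its vertices; each
   subgraph occurs once in this set, however many such maps yield it. *)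
Definition copies (W : finType) (H : sgraph W) (n : nat) :
    {set {set 'I_n} * {set {set 'I_n}}} :=
  [set S | [exists f : {ffun W -> 'I_n},
     injectiveb f &&
     (S == (f @: [set: W], [set f @: (e : {set W}) | e in edges H]))]].

Section RandomGraphs.
Variable R : realType.

Definition signed_count (W : finType) (H : sgraph W) (n : nat)
    (G : sgraph 'I_n) : R :=
  \sum_(S in copies H n) \prod_(e in S.2) (2 * (e \in edges G)%:R - 1).

(* The laws of random graphs on the vertex set 'I_n are given by their
   probability mass functions. *)

Definition erdos_renyi (q : R) (n : nat) (G : sgraph 'I_n) : R :=
  \prod_(i < n) \prod_(j < n | (i < j)%N) (if adj G i j then q else 1 - q).

Definition G_half (n : nat) : sgraph 'I_n -> R :=
  @erdos_renyi 2^-1 n.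

Definition is_sbm (k : nat) (p : 'I_k -> R) (Q : 'M[R]_k) : Prop :=
  [/\ forall a, 0 < p a <= 1,
      \sum_a p a = 1,
      Q^T = Q
    & forall a b, -1 <= Q a b <= 1].

Definition sbm_edge_prob (k : nat) (Q : 'M[R]_k) (a b : 'I_k) : R :=
  (1 + Q a b) / 2.

(* The outer sum runs over the labellings x of the vertices. *)
Definition sbm (k : nat) (p : 'I_k -> R) (Q : 'M[R]_k) (n : nat)
    (G : sgraph 'I_n) : R :=
  \sum_(x : {ffun 'I_n -> 'I_k})
    (\prod_(i < n) p (x i)) *
    \prod_(i < n) \prod_(j < n | (i < j)%N)
      (if adj G i j then sbm_edge_prob Q (x i) (x j)
       else 1 - sbm_edge_prob Q (x i) (x j)).

Definition mean (n : nat) (mu : sgraph 'I_n -> R) (f : sgraph 'I_n -> R) : R :=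
  \sum_(G : sgraph 'I_n) mu G * f G.

Definition variance (n : nat) (mu : sgraph 'I_n -> R) (f : sgraph 'I_n -> R) :
    R :=
  mean mu (fun G => (f G - mean mu f) ^+ 2).

Section Distinguishing.
Local Open Scope classical_set_scope.
Variables (P : forall n, sgraph 'I_n -> R) (f : forall n, sgraph 'I_n -> R).

Definition mean_gap (n : nat) : R :=
  `|mean (@P n) (@f n) - mean (@G_half n) (@f n)|.

Definition max_deviation (n : nat) : R :=
  Num.max (Num.sqrt (variance (@G_half n) (@f n)))
          (Num.sqrt (variance (@P n) (@f n))).

(* u = omega(v) is the same as v = o(u). *)
Definition distinguishes : Prop := max_deviation =o_\oo mean_gap.

Definition fails_to_distinguish : Prop := mean_gap =o_\oo max_deviation.

End Distinguishing.

Definition balanced2 (a : 'I_2) : R := 2^-1.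

End RandomGraphs.

(* Main.v *)
Require Import Defs.
From mathcomp Require Import all_boot all_order all_algebra.
From mathcomp Require Import all_classical all_reals all_analysis.
From mathcomp Require Import ring lra zify.

Set Implicit Arguments.
Unset Strict Implicit.
Unset Printing Implicit Defensive.

Import Order.TTheory GRing.Theory Num.Theory.
Import numFieldNormedType.Exports.

Local Open Scope ring_scope.

(** Take Q constant, equal to a bias q = (n+1)^(-7/8): the block model is then an
    Erdos-Renyi graph with edge probability (1 + q) / 2.  If H has v vertices,
    e edges and N copies in K_n, the gap of means is N q^e, and the standard
    deviation under G(n, 1/2) is at least sqrt N.  For a single edge both
    variances are at most N, and sqrt N * q grows like n^(1/8).  A connected H
    with e >= 2 has v <= e + 1, hence N <= n^(e+1), and sqrt N * q^e is at most
    n^(3/2) q^2 = O(n^(-1/4)). *)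

(** * Edge counts of connected graphs *)

Lemma adj_sym (V : finType) (G : sgraph V) : symmetric (adj G).
Proof. by move=> x y; rewrite /adj finset.setUC. Qed.

Lemma card_edge (V : finType) (G : sgraph V) e : e \in edges G -> #|e| = 2%N.
Proof. by move=> eG; have := fintype.subsetP (valP G) e eG; rewrite inE => /eqP. Qed.

(** A vertex set grows from [r] one vertex at a time, and each new vertex brings at least one new
    edge inside the set. *)
Lemma connected_card_le (V : finType) (G : sgraph V) :
  connected_graph G -> (#|V| <= #|edges G|.+1)%N.
Proof.
case=> /card_gt0P[r _] conG.
suff grow k : (k < #|V|)%N -> exists S : {set V},
    [/\ r \in S, #|S| = k.+1 &
        (k <= #|[set e in edges G | e \subset S]|)%N].
  have V0 : (0 < #|V|)%N by apply/card_gt0P; exists r.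
  have [|S [_ _ leS]] := grow #|V|.-1; first by rewrite prednK.
  rewrite -(prednK V0) ltnS (leq_trans leS)//.
  by apply: subset_leq_card; apply/fintype.subsetP => e; rewrite inE => /andP[].
elim: k => [_|k IHk ltkV].
  by exists [set r]; rewrite finset.set11 cards1.
have [S [rS cS leS]] := IHk (ltnW ltkV).
have [y yS] : exists y, y \notin S.
  apply/existsP; rewrite -negb_forall; apply/negP => /forallP allS.
  have : #|S| = #|V| by apply: eq_card => y; rewrite allS.
  by move=> eSV; move: ltkV; rewrite -eSV cS ltnn.
(* If no edge left [S], then [S] would be closed under adjacency and would contain [y], which is
   reachable from [r]. *)
have [x [z [xS zS xz]]] : exists x z, [/\ x \in S, z \notin S & adj G x z].
  apply: contrapT => noedge.
  suff clS : fingraph.closed (adj G) S.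
    by move: yS; rewrite -(closed_connect clS (conG r y)) rS.
  apply: intro_closed; first exact/sym_connect_sym/adj_sym.
  move=> x z xz xS; apply: contrapT => /negP zS.
  by apply: noedge; exists x, z.
exists (z |: S); split; first by rewrite in_setU1 rS orbT.
  by rewrite cardsU1 zS cS.
apply: (leq_trans (n := #|[set x; z] |: [set e in edges G | e \subset S]|)).
  rewrite cardsU1 !inE [_ \in _]xz/= finset.subUset !finset.sub1set.
  by rewrite (negPf zS) andbF /= add1n ltnS.
apply: subset_leq_card; apply/fintype.subsetP => e.
rewrite in_setU1 inE => /orP[/eqP->|]; rewrite inE.
  rewrite [_ \in _]xz finset.subUset !finset.sub1set !in_setU1 xS eqxx.
  by rewrite orbT.
move=> /andP[-> eS] /=; exact/(fintype.subset_trans eS)/finset.subsetUr.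
Qed.

(** By the previous bound there are at most two vertices, so the edge is the whole vertex set. Hence
    the graphs that must fail have at least two edges. *)
Lemma one_edge_isomorphic_star1 (V : finType) (G : sgraph V) :
  connected_graph G -> #|edges G| = 1%N -> isomorphic G star1.
Proof.
move=> conG /eqP/cards1P[e0 eG].
have ce0 : #|e0| = 2%N by apply: (@card_edge _ G); rewrite eG finset.set11.
have leV := connected_card_le conG; rewrite eG cards1 in leV.
have e0T : e0 = [set: V].
  by apply/eqP; rewrite eqEcard finset.subsetT cardsT ce0.
have cV : #|V| = 2%N by rewrite -cardsT -e0T.
pose f x := cast_ord cV (enum_rank x).
pose g i := enum_val (cast_ord (esym cV) i) : V.
have fg : cancel f g by move=> x; rewrite /f /g cast_ordK enum_rankK.
have gf : cancel g f by move=> x; rewrite /f /g enum_valK cast_ordKV.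
exists f; first by exists g.
move=> x y; rewrite /adj eG e0T !inE.
have -> : [set f x; f y] = f @: [set x; y] by rewrite imsetU1 imset_set1.
have -> : [set: 'I_2] = f @: [set: V].
  apply/finset.setP => i; rewrite finset.in_setT; apply/esym/imsetP.
  by exists (g i); rewrite ?finset.in_setT ?gf.
by rewrite (inj_eq (imset_inj (can_inj fg))).
Qed.

(** * Copies of a graph in the complete graph *)

Definition vpairs (n : nat) : {set {set 'I_n}} :=
  [set e : {set 'I_n} | #|e| == 2].

Section Copies.
Variables (W : finType) (H : sgraph W) (n : nat).

Lemma copiesP (S : {set 'I_n} * {set {set 'I_n}}) :
  reflect (exists2 f : {ffun W -> 'I_n}, injective f &
     S = (f @: [set: W], [set f @: (e : {set W}) | e in edges H]))
    (S \in copies H n).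
Proof.
rewrite inE; apply: (iffP existsP) => [[f /andP[/injectiveP fi /eqP->]]|].
  by exists f.
by move=> [f fi ->]; exists f; rewrite eqxx andbT; apply/injectiveP.
Qed.

Lemma copy_edges_sub S : S \in copies H n -> S.2 \subset vpairs n.
Proof.
move=> /copiesP[f fi ->]; apply/fintype.subsetP => _ /imsetP[e eH ->].
by rewrite inE card_imset// (card_edge eH).
Qed.

Lemma card_copy_edges S : S \in copies H n -> #|S.2| = #|edges H|.
Proof. by move=> /copiesP[f fi ->]; rewrite card_imset//; exact: imset_inj. Qed.

Lemma card_copies_le : (#|copies H n| <= n ^ #|W|)%N.
Proof.
rewrite -[n in (n ^ _)%N]card_ord -card_ffun.
pose h (f : {ffun W -> 'I_n}) :=
  (f @: [set: W], [set f @: (e : {set W}) | e in edges H]).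
apply: leq_trans (leq_imset_card h {ffun W -> 'I_n}).
apply: subset_leq_card; apply/fintype.subsetP => S /copiesP[f _ ->].
by apply/imsetP; exists f.
Qed.

End Copies.

Lemma star1_copyE n S : S \in copies star1 n -> S.2 = [set S.1].
Proof. by move=> /copiesP[f _ ->] /=; rewrite imset_set1. Qed.

Lemma card_star1_copies_ge n : ('C(n, 2) <= #|copies star1 n|)%N.
Proof.
rewrite -[n in 'C(n, _)]card_ord -card_draws.
rewrite -(@card_imset _ _ (fun e : {set 'I_n} => (e, [set e]))); last first.
  by move=> e e' [].
apply: subset_leq_card; apply/fintype.subsetP => _ /imsetP[e + ->].
rewrite inE => /cards2P[x [y [xy ->]]]; apply/copiesP.
pose f := [ffun i : 'I_2 => if i == ord0 then x else y].
have fT : f @: [set: 'I_2] = [set x; y].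
  apply/finset.setP => z; apply/imsetP/set2P => [[i _ ->]|[->|->]].
  - by rewrite ffunE; case: eqP; [left|right].
  - by exists ord0; rewrite ?ffunE.
  - by exists ord_max; rewrite ?ffunE.
exists f; last by rewrite imset_set1 fT.
move=> i j; rewrite !ffunE => fij; apply: val_inj; move: fij xy.
by case: i j => [[|[|//]]] ? [[|[|//]]] ? //= ->; rewrite eqxx.
Qed.

(** The constant 16 suffices from [n = 2] on and is a square: the square root of the number of edges
    of K_n is at least [n.+1 / 4]. *)
Lemma sqr_leq_bin2 n : (1 < n)%N -> (n.+1 ^ 2 <= 16 * 'C(n, 2))%N.
Proof.
have : ('C(n, 2) * 2 = n * n.-1)%N.
  by rewrite (bin_ffact n 2) ffactnSr ffactn1 subn1.
by case: n => [|[|n]] //= binE _; rewrite -mulnn; nia.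
Qed.

(** * Moments of signed counts under Erdős-Rényi laws *)

Section RandomGraphMoments.
Variable R : realType.

(** The Fourier-Walsh character of [A]; a signed count is a sum of such characters over copies. *)
Definition edge_char n (A : {set {set 'I_n}}) (G : sgraph 'I_n) : R :=
  \prod_(e in A) (2 * (e \in edges G)%:R - 1).

Lemma prod_ordered_pairs n (F : {set 'I_n} -> R) :
  \prod_(i < n) \prod_(j < n | (i < j)%N) F [set i; j] =
  \prod_(e in vpairs n) F e.
Proof.
rewrite pair_big_dep /=.
pose D : {set 'I_n * 'I_n} :=
  [set p : 'I_n * 'I_n | (p.1 < p.2)%N].
pose h (p : 'I_n * 'I_n) : {set 'I_n} := [set p.1; p.2].
have hD : vpairs n = h @: D.
  apply/finset.setP => e; rewrite inE; apply/cards2P/imsetP => [[x [y [xy ->]]]|].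
    have [ltxy|ltyx|/val_inj exy] := ltngtP x y.
    - by exists (x, y); rewrite ?inE.
    - by exists (y, x); rewrite ?inE// /h finset.setUC.
    - by rewrite exy eqxx in xy.
  move=> [[x y]]; rewrite inE/= => ltxy ->; exists x, y; split=> //.
  by apply: contraTneq ltxy => ->; rewrite ltnn.
rewrite hD big_imset/=; first by apply: eq_bigl => p; rewrite inE.
move=> [a b] [c d]; rewrite !inE /h/= => ltab ltcd E.
have : a \in [set c; d] by rewrite -E set21.
have : b \in [set c; d] by rewrite -E set22.
have : c \in [set a; b] by rewrite E set21.
rewrite !inE => /orP[]/eqP ? /orP[]/eqP ? /orP[]/eqP ?; subst => //.
all: by [rewrite ltnn in ltab | rewrite ltnn in ltcd
        | have := ltn_trans ltab ltcd; rewrite ltnn].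
Qed.

Lemma erdos_renyiE (p : R) n (G : sgraph 'I_n) :
  erdos_renyi p G =
  \prod_(e in vpairs n) (if e \in edges G then p else 1 - p).
Proof.
exact: (prod_ordered_pairs (fun e => if e \in edges G then p else _)).
Qed.

(** Edges are independent, and each sign has mean [2 * p - 1]. *)
Lemma mean_edge_char (p : R) n (A : {set {set 'I_n}}) : A \subset vpairs n ->
  mean (@erdos_renyi R p n) (edge_char A) = (2 * p - 1) ^+ #|A|.
Proof.
move=> /fintype.subsetP AD.
(* [a e] and [b e] are the signed weights of [e] being present or absent. Outside [vpairs n] the
   values 0 and 1 force absence, so the expanded product retains exactly the edge sets of graphs. *)
pose a (e : {set 'I_n}) : R := if e \in vpairs n then p else 0.
pose b (e : {set 'I_n}) : R :=
  if e \in vpairs n then (if e \in A then p - 1 else 1 - p) else 1.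
transitivity (\prod_e (a e + b e)); last first.
  rewrite -prodr_const [RHS]big_mkcond/=; apply: eq_bigr => e _.
  rewrite /a /b; have [eA|eA] := boolP (e \in A).
    by rewrite (AD _ eA); ring.
  by case: ifP => _; rewrite ?add0r// addrC subrK.
rewrite bigA_distr /mean.
rewrite (bigID (fun J : {set {set 'I_n}} => J \subset vpairs n))/=.
rewrite [X in _ + X]big1 ?addr0 => [|J]; last first.
  case/fintype.subsetPn => e eJ eD.
  by rewrite (bigD1 e)//= eJ /a (negPf eD) mul0r.
rewrite (reindex_omap (val : sgraph 'I_n -> _) insub) => [|J JD]; last first.
  by rewrite (insubT (fun J : {set {set 'I_n}} => J \subset _) JD).
apply: eq_big => [G|G _]; first by rewrite valK eqxx andbT (valP G).
rewrite erdos_renyiE /edge_char (big_mkcond (mem (vpairs n))).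
rewrite (big_mkcond (mem A)) -big_split/=; apply: eq_bigr => e _.
rewrite /a /b; have [eD|eD] := boolP (e \in vpairs n); last first.
  have [/(fintype.subsetP (valP G))|_] := boolP (e \in edges G).
    by rewrite -/(vpairs n) (negPf eD).
  by rewrite mul1r (contraNF (AD e) eD).
by case: (e \in A); case: (e \in edges G) => /=; ring.
Qed.

(** Signs square to 1, so common edges cancel and the symmetric difference remains. *)
Lemma edge_charM n (A B : {set {set 'I_n}}) (G : sgraph 'I_n) :
  edge_char A G * edge_char B G = edge_char ((A :\: B) :|: (B :\: A)) G.
Proof.
rewrite /edge_char (big_mkcond (mem A)) (big_mkcond (mem B)).
rewrite (big_mkcond (mem (_ :|: _))) -big_split/=.
apply: eq_bigr => e _; rewrite !inE.
by case: (e \in A); case: (e \in B); case: (e \in edges G) => /=; ring.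
Qed.

Lemma mean_sum n (mu : sgraph 'I_n -> R) (I : finType) (P : pred I)
    (f : I -> sgraph 'I_n -> R) :
  mean mu (fun G => \sum_(i | P i) f i G) = \sum_(i | P i) mean mu (f i).
Proof. by rewrite exchange_big; apply: eq_bigr => G _; rewrite mulr_sumr. Qed.

Lemma varianceE n (mu : sgraph 'I_n -> R) f : mean mu (fun=> 1) = 1 ->
  Defs.variance mu f = mean mu (fun G => f G * f G) - mean mu f ^+ 2.
Proof.
move=> mu1; rewrite /Defs.variance.
have expand m : mean mu (fun G => (f G - m) ^+ 2) =
    mean mu (fun G => f G * f G) - 2 * m * mean mu f
    + m ^+ 2 * mean mu (fun=> 1).
  rewrite /mean !mulr_sumr -sumrB -big_split/=.
  by apply: eq_bigr => G _; ring.
by rewrite expand mu1; ring.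
Qed.

Lemma erdos_renyi_mass (p : R) n : mean (@erdos_renyi R p n) (fun=> 1) = 1.
Proof.
have := mean_edge_char p (finset.sub0set (vpairs n)).
rewrite cards0 expr0; apply: etrans.
by congr mean; apply: funext => G; rewrite /edge_char big_set0.
Qed.

Section SignedCount.
Variables (W : finType) (H : sgraph W).

Lemma mean_signed_count (p : R) n :
  mean (@erdos_renyi R p n) (@signed_count R W H n) =
  #|copies H n|%:R * (2 * p - 1) ^+ #|edges H|.
Proof.
rewrite mean_sum mulr_natl -sumr_const; apply: eq_bigr => S SH.
by rewrite mean_edge_char ?(copy_edges_sub SH)// (card_copy_edges SH).
Qed.

Lemma mean_signed_count_sqr (p : R) n :
  mean (@erdos_renyi R p n)
       (fun G => signed_count R H G * signed_count R H G) =
  \sum_(S in copies H n) \sum_(T in copies H n)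
     (2 * p - 1) ^+ #|(S.2 :\: T.2) :|: (T.2 :\: S.2)|.
Proof.
transitivity (mean (@erdos_renyi R p n) (fun G => \sum_(S in copies H n)
    \sum_(T in copies H n) edge_char S.2 G * edge_char T.2 G)).
  congr mean; apply: funext => G; rewrite mulr_suml.
  by apply: eq_bigr => S _; rewrite mulr_sumr.
rewrite mean_sum; apply: eq_bigr => S SH.
rewrite mean_sum; apply: eq_bigr => T TH.
rewrite -mean_edge_char.
  by congr mean; apply: funext => G; rewrite -edge_charM.
by rewrite finset.subUset !(fintype.subset_trans (finset.subsetDl _ _))
  ?(copy_edges_sub SH) ?(copy_edges_sub TH).
Qed.

Lemma mean_G_half_signed_count n : (0 < #|edges H|)%N ->
  mean (@G_half R n) (@signed_count R W H n) = 0.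
Proof.
move=> H0; rewrite mean_signed_count mulfV ?pnatr_eq0// subrr expr0n.
by rewrite gtn_eqF// mulr0.
Qed.

(** At [p = 1/2] the double sum of powers of 0 has only nonnegative terms, and each diagonal term is
    1. Equality can fail: copies differing only in isolated vertices share their edges. *)
Lemma variance_G_half_signed_count_ge n : (0 < #|edges H|)%N ->
  #|copies H n|%:R <= Defs.variance (@G_half R n) (@signed_count R W H n).
Proof.
move=> H0; rewrite varianceE ?erdos_renyi_mass// mean_G_half_signed_count//.
rewrite expr0n/= subr0 mean_signed_count_sqr mulfV ?pnatr_eq0// subrr.
rewrite -sumr_const; apply: ler_sum => S SH.
rewrite (bigD1 S)//= finset.setDv finset.setU0 cards0 expr0 lerDl.
by apply: sumr_ge0 => T _; rewrite exprn_ge0.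
Qed.

End SignedCount.

(** Distinct edges are uncorrelated, and each edge sign has variance [1 - q ^+ 2], at most 1. *)
Lemma variance_star1_signed_count_le (p : R) n :
  Defs.variance (@erdos_renyi R p n) (@signed_count R _ star1 n) <=
  #|copies star1 n|%:R.
Proof.
set N : R := #|_|%:R; set q := 2 * p - 1.
rewrite varianceE ?erdos_renyi_mass// mean_signed_count -/q.
have -> : #|edges star1| = 1%N by rewrite cards1.
rewrite mean_signed_count_sqr -/q.
(* Spreading the squared mean over pairs of copies turns the variance into a termwise sum of
   covariances. *)
have -> : (N * q ^+ 1) ^+ 2 =
    \sum_(S in copies star1 n) \sum_(T in copies star1 n) q ^+ 2.
  rewrite sumr_const -(mulr_natr (\sum_(T in _) _)) sumr_const.
  by rewrite -(mulr_natr (q ^+ 2)) -/N; ring.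
rewrite -sumrB -[N]mulr1 mulr_natl -sumr_const; apply: ler_sum => S SH.
rewrite -sumrB (bigD1 S)//= finset.setDv finset.setU0 cards0 expr0.
rewrite big1 ?addr0 ?gerBl ?sqr_ge0// => T /andP[TH TS].
rewrite (star1_copyE SH) (star1_copyE TH).
have ST : S.1 != T.1.
  apply: contra_neq TS => e1; rewrite [T]surjective_pairing [S]surjective_pairing.
  by rewrite (star1_copyE SH) (star1_copyE TH) e1.
rewrite !(finset.setDidPl _); last 2 first.
- by rewrite disjoints1 inE eq_sym.
- by rewrite disjoints1 inE.
by rewrite cardsU1 inE ST cards1 subrr.
Qed.

End RandomGraphMoments.

(** * The constant block model and its bias *)

Section ConstantBlockModel.
Variable R : realType.

(** The edge factor does not depend on the labels, and the label weights sum to the [n]-th power of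
    [\sum_a p a]. *)
Lemma sbm_const_mx (k : nat) (p : 'I_k -> R) (q : R) (n : nat) :
  \sum_a p a = 1 ->
  @sbm R k p (const_mx q) n = @erdos_renyi R ((1 + q) / 2) n.
Proof.
move=> p1; apply: funext => G; rewrite /sbm.
transitivity ((\sum_(x : {ffun 'I_n -> 'I_k}) \prod_(i < n) p (x i)) *
              erdos_renyi ((1 + q) / 2) G).
  rewrite mulr_suml; apply: eq_bigr => x _; congr (_ * _).
  apply: eq_bigr => i _; apply: eq_bigr => j _.
  by rewrite /sbm_edge_prob mxE.
rewrite -(bigA_distr_bigA (fun (_ : 'I_n) a => p a)) /=.
by rewrite big1 ?mul1r.
Qed.

Lemma balanced2_sum : \sum_a balanced2 R a = 1.
Proof. by rewrite sumr_const card_ord /balanced2; lra. Qed.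

(** All fractional powers below become natural powers of this quantity; the successor keeps it at
    least 1, even at [n = 0]. *)
Definition eighth_root (n : nat) : R :=
  Num.sqrt (Num.sqrt (Num.sqrt n.+1%:R)).

Lemma eighth_rootX n : eighth_root n ^+ 8 = n.+1%:R.
Proof.
by rewrite (exprM _ 2 4) sqr_sqrtr ?sqrtr_ge0// (exprM _ 2 2)
  sqr_sqrtr ?sqrtr_ge0// sqr_sqrtr.
Qed.

Lemma eighth_root_ge1 n : 1 <= eighth_root n.
Proof.
rewrite -(@ler_pXn2r _ 8) ?nnegrE ?sqrtr_ge0//.
by rewrite expr1n eighth_rootX ler1n.
Qed.

Lemma near_eighth_root_ge (C : R) :
  \forall n \near \oo%classic, C <= eighth_root n.
Proof.
(* The maximum with 0 permits comparing eighth powers when [C] is negative. *)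
have := nbhs_infty_ger (Num.max C 0 ^+ 8); apply: filterS => n leCn.
have C0 : 0 <= Num.max C 0 by rewrite le_max lexx orbT.
apply: (@le_trans _ _ (Num.max C 0)); first by rewrite le_max lexx.
rewrite -(@ler_pXn2r _ 8) ?nnegrE ?sqrtr_ge0// eighth_rootX.
by rewrite (le_trans leCn)// ler_nat.
Qed.

(* This is (n+1)^(-7/8).  Any power strictly between n^(-1) and n^(-3/4) would do:
   above the former the edge count detects the bias, below the latter the signed
   count of the path with two edges misses it. *)
Definition bias (n : nat) : R := (eighth_root n ^+ 7)^-1.

Lemma bias_gt0 n : 0 < bias n.
Proof. by rewrite invr_gt0 exprn_gt0// (lt_le_trans ltr01)// eighth_root_ge1. Qed.

Lemma bias_le1 n : bias n <= 1.
Proof.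
by rewrite invf_le1 ?exprn_ege1 ?exprn_gt0 ?(lt_le_trans ltr01)
  ?eighth_root_ge1.
Qed.

Lemma mean_gap_bias (W : finType) (H : sgraph W) (n : nat) :
  (0 < #|edges H|)%N ->
  mean_gap (fun n => @sbm R 2 (@balanced2 R) (const_mx (bias n)) n)
           (@signed_count R W H) n =
  #|copies H n|%:R * bias n ^+ #|edges H|.
Proof.
move=> H0; rewrite /mean_gap mean_G_half_signed_count// subr0.
rewrite sbm_const_mx ?balanced2_sum// mean_signed_count.
have -> : 2 * ((1 + bias n) / 2) - 1 = bias n by field.
by rewrite ger0_norm// mulr_ge0// exprn_ge0// ltW// bias_gt0.
Qed.

Lemma max_deviation_ge0 (P f : forall n, sgraph 'I_n -> R) n :
  0 <= max_deviation P f n.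
Proof. by rewrite le_max sqrtr_ge0. Qed.

End ConstantBlockModel.

(** * The asymptotic comparison of gaps and deviations *)

Theorem theoremA3 (R : realType) :
  exists Q : nat -> 'M[R]_2,
    [/\ forall n : nat, is_sbm (@balanced2 R) (Q n),
        distinguishes (fun n => @sbm R 2 (@balanced2 R) (Q n) n)
                      (@signed_count R _ star1)
      & forall (W : finType) (H : sgraph W),
          connected_graph H -> (0 < #|edges H|)%N -> ~ isomorphic H star1 ->
          fails_to_distinguish (fun n => @sbm R 2 (@balanced2 R) (Q n) n)
                               (@signed_count R W H)].
Proof.
exists (fun n => const_mx (bias R n)); split.
- move=> n; split.
  + by move=> a; rewrite /balanced2; lra.
  + exact: balanced2_sum.
  + exact: trmx_const.
  + move=> a b; rewrite mxE bias_le1 andbT.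
    by rewrite (le_trans _ (ltW (bias_gt0 R n)))// lerN10.
- apply/eqoP => eps eps0; near=> n.
  (* With [t] the eighth root, [Num.sqrt N * bias R n] is at least [(t ^+ 8 / 4) / t ^+ 7 = t / 4],
     which has to reach [eps^-1]. *)
  have leC : 4 / eps <= eighth_root R n.
    by near: n; exact: near_eighth_root_ge.
  have n2 : (2 <= n)%N by near: n; exact: nbhs_infty_ge.
  have star1_edges : #|edges star1| = 1%N by rewrite cards1.
  rewrite ger0_norm ?max_deviation_ge0// mean_gap_bias ?star1_edges//.
  set N : R := #|_|%:R; set t := eighth_root R n in leC *.
  have t1 : 1 <= t := eighth_root_ge1 R n.
  have t0 : 0 < t := lt_le_trans ltr01 t1.
  have sqrtN0 : 0 <= Num.sqrt N := sqrtr_ge0 N.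
  have q0 : 0 <= bias R n := ltW (bias_gt0 R n).
  rewrite expr1 ger0_norm ?mulr_ge0//.
  apply: (@le_trans _ _ (Num.sqrt N)).
    rewrite ge_max /max_deviation sbm_const_mx ?balanced2_sum//.
    by rewrite !ler_sqrt ?variance_star1_signed_count_le.
  have leN : t ^+ 8 / 4 <= Num.sqrt N.
    rewrite -(@ler_pXn2r _ 2) ?nnegrE ?divr_ge0 ?exprn_ge0 ?(ltW t0)//.
    rewrite sqr_sqrtr// expr_div_n -exprM (exprM _ 8 2) eighth_rootX.
    apply: (@le_trans _ _ 'C(n, 2)%:R); last first.
      by rewrite ler_nat card_star1_copies_ge.
    have := sqr_leq_bin2 n2.
    by rewrite -(ler_nat R) natrX natrM; lra.
  have sqrtNq : eps^-1 <= Num.sqrt N * bias R n.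
    rewrite /bias -/t ler_pdivlMr ?exprn_gt0//.
    apply: le_trans leN; rewrite ler_pdivlMr// [t ^+ 8]exprS mulrAC ler_wpM2r ?exprn_ge0 ?(ltW t0)//.
    by rewrite mulrC.
  (* One factor [Num.sqrt N] of [N] bounds the deviation; the other, times the bias, absorbs
     [eps]. *)
  rewrite -[N in eps * (N * _)](sqr_sqrtr (ler0n R _)) -/N expr2 -mulrA.
  rewrite [eps * _]mulrCA ler_peMr// -(ler_pM2l (_ : 0 < eps^-1)) ?invr_gt0//.
  by rewrite mulr1 mulKf ?gt_eqF.
- move=> W H conH H0 nstar.
  have e2 : (2 <= #|edges H|)%N.
    rewrite ltn_neqAle H0 andbT; apply/eqP => e1.
    by apply: nstar; exact: one_edge_isomorphic_star1.
  apply/eqoP => eps eps0; near=> n.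
  have leC : eps^-1 <= eighth_root R n.
    by near: n; exact: near_eighth_root_ge.
  rewrite mean_gap_bias// [X in eps * X]ger0_norm ?max_deviation_ge0//.
  set N : R := #|_|%:R; set t := eighth_root R n in leC *.
  set e := #|edges H| in e2 *.
  have t1 : 1 <= t := eighth_root_ge1 R n.
  have t0 : 0 < t := lt_le_trans ltr01 t1.
  have sqrtN0 : 0 <= Num.sqrt N := sqrtr_ge0 N.
  have q0 : 0 <= bias R n := ltW (bias_gt0 R n).
  rewrite ger0_norm ?mulr_ge0 ?exprn_ge0//.
  apply: (@le_trans _ _ (eps * Num.sqrt N)); last first.
    rewrite ler_pM2l// le_max ler_sqrt ?variance_G_half_signed_count_ge//.
    exact: le_trans (variance_G_half_signed_count_ge R n H0).
  (* [N] is at most [n.+1 ^ e.+1], since [H] has at most [e.+1] vertices, and [n.+1] is [t ^+ 8]. *)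
  have leN : Num.sqrt N <= t ^+ (4 * e.+1).
    rewrite -(@ler_pXn2r _ 2) ?nnegrE ?exprn_ge0 ?(ltW t0)// sqr_sqrtr//.
    rewrite -exprM mulnAC exprM eighth_rootX -natrX ler_nat.
    rewrite (leq_trans (card_copies_le H n))//.
    apply: (@leq_trans (n.+1 ^ #|W|)); first by rewrite leq_exp2r ?conH.1.
    by rewrite leq_pexp2l// connected_card_le.
  rewrite -[X in X * _](sqr_sqrtr (ler0n R _)) -/N expr2 -mulrA mulrC.
  rewrite ler_wpM2r//.
  apply: (@le_trans _ _ (t ^+ (4 * e.+1) * bias R n ^+ e)).
    by rewrite ler_wpM2r// exprn_ge0.
  rewrite /bias -/t exprVn ler_pdivrMr ?exprn_gt0// -exprM.
  rewrite -(ler_pM2l (_ : 0 < eps^-1)) ?invr_gt0// mulKf ?gt_eqF//.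
  (* One extra factor [t] pays for [eps^-1]; then [4 * e.+1 + 1 <= 7 * e] remains, which is where
     [2 <= e] is needed. *)
  apply: (@le_trans _ _ (t ^+ (4 * e.+1).+1)).
    by rewrite exprS ler_wpM2r// exprn_ge0// ltW.
  by rewrite ler_weXn2l//; lia.
Unshelve. all: by end_near.
Qed.
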